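(* Let $P$ be a finite poset, $\mathbb{S}$ a skew field containing an infinite field as a subfield, and $C$ a central element of $\mathbb{S}$. Then $\operatorname{NAR}=\nabla\circ\Theta\circ\Delta^{-1}$ (as partial maps $\mathbb{S}^P\dashrightarrow\mathbb{S}^P$, wherever defined).
   Context: $\mathbb{S}^P$ is the set of labelings $g:P\to\mathbb{S}$; products denote composition, rightmost first; $\overline{x}=x^{-1}$. $\widehat P$ is $P$ with a new minimum $\widehat0$ and maximum $\widehat1$; $x\lessdot y$ means $y$ covers $x$ in $\widehat P$. The noncommutative antichain toggle $\tau_v$ changes only the label at $v$: $(\tau_vg)(v)=C\cdot\overline{\sum g(y_{c-1})\cdots g(y_1)\,g(y_k)\cdots g(y_c)}$, the sum over all maximal chains $y_1\lessdot\cdots\lessdot y_k$ of $P$ with $y_c=v$. $\operatorname{NAR}=\tau_{x_n}\cdots\tau_{x_2}\tau_{x_1}$ for any linear extension $(x_1,\dots,x_n)$ of $P$ (listing with $x_i<x_j\Rightarrow i<j$), i.e. toggling from bottom to top. Transfer maps: $(\Theta f)(x)=C\,\overline{f(x)}$; $(\nabla f)(x)=f(x)\,\overline{\sum_{y\lessdot x}f(y)}$ with $f(\widehat0)=1$; $(\Delta^{-1}f)(x)=\sum f(y_k)\cdots f(y_2)f(y_1)$ over all chains $x=y_1\lessdot y_2\lessdot\cdots\lessdot y_k\lessdot\widehat1$. *)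

(* Defs.v *)
From HB Require Import structures.
From mathcomp Require Import all_boot all_order all_algebra.

Set Implicit Arguments.
Unset Strict Implicit.
Unset Printing Implicit Defensive.

Import Order.TTheory GRing.Theory.
Local Open Scope ring_scope.

(* A subfield is a commutative sub-division-ring; infinite means that no
   finite list exhausts it. *)
Definition contains_infinite_field (S : unitRingType) : Prop :=
  exists K : {pred S},
    [/\ GRing.divring_closed K,
        {in K &, forall a b, a * b = b * a}
      & forall s : seq S, exists2 a, a \in K & a \notin s].

(* [hat P] is P with a new minimum [hat0] and a new maximum [hat1]. *)
Definition hat (disp : Order.disp_t) (P : finPOrderType disp) : finType :=
  option (option P).
Definition hat1 (disp : Order.disp_t) (P : finPOrderType disp) : hat P := None.
Definition hat0 (disp : Order.disp_t) (P : finPOrderType disp) : hat P :=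
  Some None.
Definition inhat (disp : Order.disp_t) (P : finPOrderType disp) (x : P) :
  hat P := Some (Some x).

Definition hat_lt (disp : Order.disp_t) (P : finPOrderType disp)
    (a b : hat P) : bool :=
  match a, b with
  | Some (Some x), Some (Some y) => (x < y)%O
  | Some None, Some (Some _) => true
  | Some _, None => true
  | _, _ => false
  end.

Definition hat_covers (disp : Order.disp_t) (P : finPOrderType disp)
    (a b : hat P) : bool :=
  hat_lt a b && [forall c, ~~ (hat_lt a c && hat_lt c b)].

Definition saturated (disp : Order.disp_t) (P : finPOrderType disp)
    (s : seq P) : bool :=
  sorted (@hat_covers _ P) [seq inhat y | y <- s].

(* y_1 covered by ... covered by y_k, to which no further element comparable
   with all of the y_i can be added. *)
Definition max_chain (disp : Order.disp_t) (P : finPOrderType disp)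
    (s : seq P) : bool :=
  saturated s &&
  [forall z : P, (z \notin s) ==> ~~ all (fun y => (y >=< z)%O) s].

(* x = y_1 covered by y_2 ... covered by y_k covered by hat1. *)
Definition up_chain (disp : Order.disp_t) (P : finPOrderType disp)
    (x : P) (s : seq P) : bool :=
  (ohead s == Some x) &&
  sorted (@hat_covers _ P) (rcons [seq inhat y | y <- s] (hat1 P)).

(* g(y_k) ... g(y_2) g(y_1) for s = (y_1, ..., y_k). *)
Definition rprod (disp : Order.disp_t) (P : finPOrderType disp)
    (S : unitRingType) (g : {ffun P -> S}) (s : seq P) : S :=
  \prod_(y <- rev s) g y.

(* Chains have at most #|P| elements, so bounding k loses nothing. For
   v = y_c, [index v y] is c - 1, so the two factors are
   g(y_{c-1}) ... g(y_1) and g(y_k) ... g(y_c). *)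
Definition toggle_sum (disp : Order.disp_t) (P : finPOrderType disp)
    (S : unitRingType) (v : P) (g : {ffun P -> S}) : S :=
  \sum_(k < #|P|.+1) \sum_(y : k.-tuple P | max_chain y && (v \in y))
    rprod g (take (index v y) y) * rprod g (drop (index v y) y).

(* Partial maps are option-valued: [None] exactly when some element to be
   inverted is 0. *)
Definition toggle (disp : Order.disp_t) (P : finPOrderType disp)
    (S : unitRingType) (C : S) (v : P) (g : {ffun P -> S}) :
    option {ffun P -> S} :=
  if toggle_sum v g != 0
  then Some [ffun x => if x == v then C * (toggle_sum v g)^-1 else g x]
  else None.

Definition linear_extension (disp : Order.disp_t) (P : finPOrderType disp)
    (s : seq P) : Prop :=
  [/\ uniq s, forall x, x \in s
    & forall x y, (x < y)%O -> (index x s < index y s)%N].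

(* tau_{x_n} o ... o tau_{x_1} for s = (x_1, ..., x_n). *)
Definition NAR (disp : Order.disp_t) (P : finPOrderType disp)
    (S : unitRingType) (C : S) (s : seq P) :
    {ffun P -> S} -> option {ffun P -> S} :=
  foldl (fun F v => pcomp (toggle C v) F) Some s.

Definition Theta (disp : Order.disp_t) (P : finPOrderType disp)
    (S : unitRingType) (C : S) (f : {ffun P -> S}) : option {ffun P -> S} :=
  if [forall x, f x != 0] then Some [ffun x => C * (f x)^-1] else None.

(* f extended by f(hat0) = 1; the value at hat1 is never used, since hat1 is
   covered by nothing. *)
Definition hat_ext (disp : Order.disp_t) (P : finPOrderType disp)
    (S : unitRingType) (f : {ffun P -> S}) (a : hat P) : S :=
  match a with
  | Some (Some x) => f x
  | Some None => 1
  | None => 0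
  end.

Definition lower_sum (disp : Order.disp_t) (P : finPOrderType disp)
    (S : unitRingType) (f : {ffun P -> S}) (x : P) : S :=
  \sum_(a : hat P | hat_covers a (inhat x)) hat_ext f a.

Definition Nabla (disp : Order.disp_t) (P : finPOrderType disp)
    (S : unitRingType) (f : {ffun P -> S}) : option {ffun P -> S} :=
  if [forall x, lower_sum f x != 0]
  then Some [ffun x => f x * (lower_sum f x)^-1]
  else None.

(* The transfer map Delta^{-1}, given by its explicit formula; it is total. *)
Definition DeltaInv (disp : Order.disp_t) (P : finPOrderType disp)
    (S : unitRingType) (f : {ffun P -> S}) : option {ffun P -> S} :=
  Some [ffun x => \sum_(k < #|P|.+1) \sum_(y : k.-tuple P | up_chain x y)
                    rprod f y].

(* Main.v *)
(** Cutting a maximal chain at [v] factors the toggle sum as [E(v) D(v)], where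
    [E(v)] sums [g(y_j) ... g(y_1)] over the saturated chains from [hat0] to
    just below [v], and [D] is Delta^{-1} g.  When bottom-to-top toggling reaches
    [v], the labels above [v] are still the original ones, so [D(v)] is
    unchanged, while the labels below are already the new ones
    [g'(y) = C D(y)^-1 E(y)^-1].  Hence
    [E(v) = sum_(y <. v) g'(y) E(y) = sum_(y <. v) C D(y)^-1], which is the sum
    inverted by Nabla.  Since [E(v) D(v) = 0] iff one of the factors vanishes,
    the domains agree as well. *)
Require Import Defs.
From HB Require Import structures.
From mathcomp Require Import all_boot all_order all_algebra.

Set Implicit Arguments.
Unset Strict Implicit.
Unset Printing Implicit Defensive.

Import Order.TTheory GRing.Theory.
Local Open Scope ring_scope.

(** * Chains in the extended poset *)

Section HatOrder.
Variables (disp : Order.disp_t) (P : finPOrderType disp).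
Implicit Types (a b c : hat P) (x y z v : P) (s : seq P).

Local Notation hc := (@hat_covers disp P).
Local Notation hl := (@hat_lt disp P).

Lemma hat_lt_trans : transitive hl.
Proof.
by move=> [[y|]|] [[x|]|] [[z|]|] //=; apply: lt_trans.
Qed.

Lemma hat_lt_irr : irreflexive hl.
Proof. by move=> [[x|]|] //=; rewrite ltxx. Qed.

Lemma inhat_inj : injective (@inhat disp P).
Proof. by move=> x y []. Qed.

Lemma hat_covers_lt a b : hc a b -> hl a b.
Proof. by case/andP. Qed.

Lemma covers_inhat_lt x y : hc (inhat x) (inhat y) -> (x < y)%O.
Proof. exact: hat_covers_lt. Qed.

Lemma hat0_covers v : hc (hat0 P) (inhat v) = [forall z, ~~ (z < v)%O].
Proof.
apply/idP/idP.
  case/andP=> _ /forallP H; apply/forallP=> z.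
  by move: (H (inhat z)).
by move/forallP=> H; apply/forallP=> -[[z|]|] //=; apply: H.
Qed.

Lemma covers_hat1 v : hc (inhat v) (hat1 P) = [forall z, ~~ (v < z)%O].
Proof.
apply/idP/idP.
  case/andP=> _ /forallP H; apply/forallP=> z.
  by move: (H (inhat z)); rewrite /= andbT.
by move/forallP=> H; apply/forallP=> -[[z|]|] //=; rewrite andbT; apply: H.
Qed.

Lemma path_covers_uniq a (l : seq (hat P)) : path hc a l -> uniq (a :: l).
Proof.
move=> H; apply: (sorted_uniq hat_lt_trans hat_lt_irr).
by apply: sub_path H => b c; apply: hat_covers_lt.
Qed.

Definition full_chain s := path hc (hat0 P) (rcons (map (@inhat _ P) s) (hat1 P)).

(** Climb the chain, keeping [z] strictly above the current element. If [z] is comparable with the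
    next element, it cannot lie below it, as it would then sit inside a cover; so it lies above. At
    the top [z] would sit strictly between the last element and [hat1], again inside a cover. *)
Lemma path_covers_comparable a s z :
  hl a (inhat z) -> path hc a (rcons (map (@inhat _ P) s) (hat1 P)) ->
  z \notin s -> ~~ all (fun y => (y >=< z)%O) s.
Proof.
elim: s a => [|y s IH] a /= az.
  by case/andP=> /andP[_ /forallP/(_ (inhat z))]; rewrite az.
case/andP=> ay ys; rewrite inE negb_or => /andP[zy zs].
apply/negP=> /andP[cmp]; apply/negP; apply: IH ys zs => /=.
case/orP: cmp; first by rewrite le_eqVlt eq_sym (negPf zy).
rewrite le_eqVlt (negPf zy) /= => lzy.
by case/andP: ay => _ /forallP/(_ (inhat z)); rewrite az /= lzy.
Qed.

(** Turns maximality into a local condition, which can be cut at any point. An element below the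
    first or above the last would extend the chain; the converse is [path_covers_comparable] started
    at [hat0]. *)
Lemma max_chainE s : s != [::] -> max_chain s = full_chain s.
Proof.
case: s => // y s _; rewrite /max_chain /full_chain /saturated /= rcons_path.
have minP x l : path (@hat_lt _ P) (inhat x) (map (@inhat _ P) l) ->
    all (fun z => (x < z)%O) l.
  by move/(order_path_min hat_lt_trans); rewrite all_map.
apply/idP/idP.
  case/andP=> ys /forallP mx; rewrite ys /=.
  have {}mx z : (forall u, u \in y :: s -> (u >=< z)%O && (u != z)) -> False.
    move=> H; move: (mx z); apply/negP; rewrite negb_imply negbK.
    apply/andP; split; first by apply/negP=> /H; rewrite eqxx andbF.
    by change (all (fun u => (u >=< z)%O) (y :: s)); apply/allP=> u /H/andP[].
  have {}ys : path hl (inhat y) (map (@inhat _ P) s).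
    by apply: sub_path ys => b c; apply: hat_covers_lt.
  apply/andP; split.
    rewrite hat0_covers; apply/forallP=> z; apply/negP=> zy.
    have zall : all (fun u => (z < u)%O) (y :: s) by apply: minP; rewrite /= zy.
    apply: (mx z) => u /(allP zall) zu.
    by rewrite comparable_sym lt_comparable // gt_eqF.
  rewrite last_map covers_hat1; apply/forallP=> z; apply/negP=> zy.
  apply: (mx z) => u us; suff uz : (u < z)%O by rewrite lt_comparable // lt_eqF.
  (* Splitting the chain right after [u] shows that [u] is at most the last element, which is below
     [z]. *)
  apply: le_lt_trans zy; case/splitPl: s / us ys {mx} => p1 p2 <-.
  rewrite map_cat cat_path last_map last_cat => /andP[_ /minP] /allP H.
  case: p2 H => [|w p2] H //=; exact/ltW/H/mem_last.
case/and3P=> y0 ys y1; rewrite ys; apply/forallP=> z; apply/implyP=> zs.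
apply: (@path_covers_comparable (hat0 P) (y :: s)) zs => //=.
by rewrite y0 rcons_path ys.
Qed.

(** The sequence [s] stops just below [v], while [up_chain v] starts with [v], so the two pieces
    concatenate without overlap. *)
Definition down_chain v s :=
  path hc (hat0 P) (rcons (map (@inhat _ P) s) (inhat v)).

Lemma up_chain_cons x y s : up_chain x (y :: s) =
  (y == x) && path hc (inhat y) (rcons (map (@inhat _ P) s) (hat1 P)).
Proof. by []. Qed.

Lemma full_chain_cat v s t :
  full_chain (s ++ v :: t) = down_chain v s && up_chain v (v :: t).
Proof.
rewrite up_chain_cons eqxx /full_chain /down_chain map_cat rcons_cat cat_path.
by rewrite [in RHS]rcons_path -andbA.
Qed.

Lemma down_chain_rcons v s y :
  down_chain v (rcons s y) = down_chain y s && hc (inhat y) (inhat v).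
Proof.
by rewrite /down_chain map_rcons rcons_path last_rcons.
Qed.

Lemma down_chain_nil v : down_chain v [::] = hc (hat0 P) (inhat v).
Proof. by rewrite /down_chain /= andbT. Qed.

Lemma full_chain_uniq s : full_chain s -> uniq s.
Proof.
by move/path_covers_uniq => /= /andP[_];
  rewrite rcons_uniq (map_inj_uniq inhat_inj) => /andP[].
Qed.

Lemma down_chain_uniq v s : down_chain v s -> uniq (rcons s v).
Proof.
by move/path_covers_uniq => /= /andP[_];
  rewrite -map_rcons (map_inj_uniq inhat_inj).
Qed.

Lemma up_chain_uniq v s : up_chain v s -> uniq s.
Proof.
case: s => // y s; rewrite up_chain_cons => /andP[_ /path_covers_uniq].
by rewrite -rcons_cons rcons_uniq (@map_inj_uniq _ _ _ inhat_inj (y :: s)) => /andP[].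
Qed.

Lemma up_chain_ge v s y : up_chain v s -> y \in s -> (v <= y)%O.
Proof.
case: s => // x s; rewrite up_chain_cons => /andP[/eqP -> H].
have {}H : path hl (inhat v) (rcons (map (@inhat _ P) s) (hat1 P)).
  by apply: sub_path H => b c; apply: hat_covers_lt.
move/(order_path_min hat_lt_trans): H.
rewrite all_rcons all_map inE /= => /allP H /predU1P[->//|/H]; exact: ltW.
Qed.

(** * Chains listed without repetition, for reindexing sums *)

Lemma uniq_size_card s : uniq s -> (size s < #|P|.+1)%N.
Proof. by move/card_uniqP <-; rewrite ltnS max_card. Qed.

(** Forgetting the tuple lengths turns the double sums of the definitions into sums over one list,
    which [perm_big] can reindex. *)
Definition short_seqs : seq (seq P) :=
  flatten [seq [seq tval t | t <- enum {: k.-tuple P}] | k <- iota 0 #|P|.+1].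

Lemma mem_short_seqs s : (s \in short_seqs) = (size s < #|P|.+1)%N.
Proof.
apply/flatten_mapP/idP.
  case=> k; rewrite mem_iota => /andP[_ kP] /mapP[t _ ->].
  by rewrite size_tuple.
move=> sP; exists (size s); first by rewrite mem_iota.
by apply/mapP; exists (in_tuple s); rewrite ?mem_enum.
Qed.

Lemma short_seqs_uniq : uniq short_seqs.
Proof.
rewrite /short_seqs; elim: (#|P|.+1) 0%N => [|n IH] m //=.
rewrite cat_uniq IH andbT map_inj_uniq ?enum_uniq /=; last exact: val_inj.
apply/hasPn=> s /flatten_mapP[k]; rewrite mem_iota => /andP[mk _] /mapP[t _ ->].
apply/negP=> /mapP[u _ tu]; have:= congr1 size tu; rewrite !size_tuple => km.
by rewrite km ltnn in mk.
Qed.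

Definition chains (p : pred (seq P)) := [seq s <- short_seqs | p s].

Lemma mem_chains (p : pred (seq P)) s :
  (forall t, p t -> uniq t) -> (s \in chains p) = p s.
Proof.
move=> pu; rewrite mem_filter mem_short_seqs.
by case ps: (p s) => //=; apply/uniq_size_card/pu.
Qed.

Lemma chains_uniq p : uniq (chains p).
Proof. exact/filter_uniq/short_seqs_uniq. Qed.

Lemma sum_tuple_chains (V : nmodType) (p : pred (seq P)) (F : seq P -> V) :
  \sum_(k < #|P|.+1) \sum_(y : k.-tuple P | p y) F y = \sum_(y <- chains p) F y.
Proof.
rewrite big_filter big_flatten big_map.
rewrite -[iota 0 #|P|.+1]/(index_iota 0 #|P|.+1) big_mkord.
apply: eq_bigr => k _; by rewrite big_map big_enum_cond.
Qed.

Lemma sum_hat (V : nmodType) (Q : pred (hat P)) (F : hat P -> V) :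
  ~~ Q (hat1 P) ->
  \sum_(a | Q a) F a = (if Q (hat0 P) then F (hat0 P) else 0) +
    \sum_(x | Q (inhat x)) F (inhat x).
Proof.
move=> Q1.
have -> : \sum_(a | Q a) F a =
    \sum_(a <- [:: hat1 P, hat0 P & [seq inhat x | x <- enum P]] | Q a) F a.
  apply: perm_big; apply: uniq_perm.
  - exact: index_enum_uniq.
  - rewrite /= (map_inj_uniq inhat_inj) enum_uniq inE /= !andbT.
    by apply/andP; split; apply/negP=> /mapP[].
  - move=> [[x|]|]; rewrite mem_index_enum !inE //=.
    by symmetry; apply/mapP; exists x; rewrite ?mem_enum.
rewrite !big_cons (negPf Q1) big_map big_enum_cond /=.
by case: ifP => //; rewrite add0r.
Qed.

End HatOrder.

(** * Sums over chains and their factorization *)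

Section Transfer.
Variables (disp : Order.disp_t) (P : finPOrderType disp) (S : unitRingType).
Implicit Types (x y z v : P) (s : seq P) (f g : {ffun P -> S}).

Local Notation hc := (@hat_covers disp P).

Definition up_sum g v : S := \sum_(s <- chains (@up_chain _ P v)) rprod g s.

Definition down_sum g v : S := \sum_(s <- chains (down_chain v)) rprod g s.

Lemma DeltaInvE g : DeltaInv g = Some [ffun x => up_sum g x].
Proof.
congr Some; apply/ffunP=> x; rewrite !ffunE.
exact: (sum_tuple_chains (up_chain x)).
Qed.

Lemma rprod_rcons g s y : rprod g (rcons s y) = g y * rprod g s.
Proof. by rewrite /rprod rev_rcons big_cons. Qed.

Lemma eq_rprod f g s : {in s, f =1 g} -> rprod f s = rprod g s.
Proof.
by move=> fg; apply: eq_big_seq => y; rewrite mem_rev; apply: fg.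
Qed.

Lemma eq_up_sum f g v :
  (forall y, (v <= y)%O -> f y = g y) -> up_sum f v = up_sum g v.
Proof.
move=> fg; apply: eq_big_seq => s; rewrite mem_filter => /andP[vs _].
by apply: eq_rprod => y /(up_chain_ge vs); apply: fg.
Qed.

Lemma toggle_sumE g v : toggle_sum v g = down_sum g v * up_sum g v.
Proof.
rewrite /toggle_sum (sum_tuple_chains (fun s => max_chain s && (v \in s))
  (fun s => rprod g (take (index v s) s) * rprod g (drop (index v s) s))).
have dP s : (s \in chains (down_chain v)) = down_chain v s.
  by apply: mem_chains => t /down_chain_uniq; rewrite rcons_uniq => /andP[].
have uP s : (s \in chains (up_chain v)) = up_chain v s.
  by apply: mem_chains => t; apply: up_chain_uniq.
have mP s : (s \in chains (fun s => max_chain s && (v \in s))) =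
    full_chain s && (v \in s).
  have mE t : max_chain t && (v \in t) = full_chain t && (v \in t).
    by case: t => [|y t]; rewrite ?andbF // max_chainE.
  rewrite mem_chains; first exact: mE.
  by move=> t; rewrite mE => /andP[/full_chain_uniq].
(* The position of [v] recovers the cut: [v] is absent from [s] and heads [t]. This gives
   injectivity of concatenation and evaluates [take] and [drop]. *)
have idx s t : down_chain v s -> up_chain v t -> index v (s ++ t) = size s.
  move/down_chain_uniq; rewrite rcons_uniq => /andP[vs _].
  case: t => // y t; rewrite up_chain_cons => /andP[/eqP-> _].
  by rewrite index_cat (negPf vs) /= eqxx addn0.
rewrite (perm_big [seq s ++ t | s <- chains (down_chain v),
                                t <- chains (up_chain v)]) /=; last first.
  apply: uniq_perm; first exact: chains_uniq.
    apply: allpairs_uniq; try exact: chains_uniq.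
    move=> p q /allpairsP[[s t] /= [ds ut ->]] /allpairsP[[s' t'] /= [ds' ut' ->]].
    rewrite dP in ds; rewrite dP in ds'; rewrite uP in ut; rewrite uP in ut'.
    move=> /= e; have := idx _ _ ds ut; rewrite e idx // => ss.
    by move/eqP: e; rewrite eqseq_cat // => /andP[/eqP-> /eqP->].
  move=> y; rewrite mP; apply/andP/allpairsP.
    case=> fy vy; move: fy; case/splitPr: vy => s t.
    by rewrite full_chain_cat => /andP[ds ut]; exists (s, v :: t); rewrite dP uP.
  case=> -[s t] /= []; rewrite dP uP => ds ut ->.
  case: t ut => // x t ut; have xv : x = v by case/andP: ut => /eqP[].
  by rewrite xv in ut *; rewrite full_chain_cat ds ut mem_cat mem_head orbT.
rewrite big_allpairs_dep /down_sum mulr_suml; apply: eq_big_seq => s.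
rewrite dP => ds; rewrite /up_sum mulr_sumr; apply: eq_big_seq => t.
by rewrite uP => ut; rewrite idx // take_size_cat // drop_size_cat.
Qed.

(** Sort the chains by their last element [y], whose label is the leftmost factor. The empty chain
    contributes 1, exactly when [v] is minimal. *)
Lemma down_sumE g v : down_sum g v =
  (if hc (hat0 P) (inhat v) then 1 else 0) +
  \sum_(y | hc (inhat y) (inhat v)) g y * down_sum g y.
Proof.
have dP u s : (s \in chains (down_chain u)) = down_chain u s.
  by apply: mem_chains => t /down_chain_uniq; rewrite rcons_uniq => /andP[].
pose low := [seq y <- enum P | hc (inhat y) (inhat v)].
rewrite /down_sum (perm_big
  ((if hc (hat0 P) (inhat v) then [:: [::]] else [::]) ++
   [seq rcons s y | y <- low, s <- chains (down_chain y)])) /=; last first.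
  apply: uniq_perm; first exact: chains_uniq.
    rewrite cat_uniq; apply/and3P; split; first by case: ifP.
      apply/hasPn=> s /allpairsPdep[y [t [_ _ ->]]].
      by case: ifP => //= _; rewrite inE; case: t.
    apply: allpairs_uniq_dep; first exact/filter_uniq/enum_uniq.
      by move=> y _; apply: chains_uniq.
    by move=> [y s] [z t] _ _ /= /rcons_inj[-> ->].
  move=> s; rewrite dP mem_cat; case/lastP: s => [|s y].
    rewrite down_chain_nil; case: ifP => //= _; symmetry.
    by apply/negP=> /allpairsPdep[y [[|? ?] [_ _]]].
  rewrite down_chain_rcons.
  have -> : (rcons s y \in if hc (hat0 P) (inhat v) then [:: [::]] else [::])
    = false by case: ifP => // _; rewrite inE; case: s.
  apply/andP/allpairsPdep.
    case=> ds yv; exists y, s; split=> //; last by rewrite dP.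
    by rewrite mem_filter yv mem_enum.
  case=> z [t [zl dt /rcons_inj[-> ->]]].
  by move: zl dt; rewrite mem_filter dP => /andP[].
rewrite big_cat big_allpairs_dep big_filter big_enum_cond /=; congr (_ + _).
  by case: ifP; rewrite ?big_seq1 ?big_nil // /rprod big_nil.
apply: eq_bigr => y _; rewrite mulr_sumr; apply: eq_bigr => s _.
by rewrite rprod_rcons.
Qed.

(** Same shape as [down_sumE], so that the two can be compared term by term. *)
Lemma lower_sumE f v : lower_sum f v =
  (if hc (hat0 P) (inhat v) then 1 else 0) +
  \sum_(y | hc (inhat y) (inhat v)) f y.
Proof. by rewrite /lower_sum sum_hat. Qed.

(** * Toggling along a linear extension *)

Hypothesis S_skew_field : GRing.field_axiom S.
Variables (C : S) (g : {ffun P -> S}).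

(** Without the domain tests, [f] is Theta after Delta^{-1} applied to [g], and [h] is Nabla of [f].
    The labeling reached after toggling the elements of [p] will be [state p]. *)
Let f := [ffun x => C * (up_sum g x)^-1].
Let h := [ffun x => f x * (lower_sum f x)^-1].
Let state (p : seq P) := [ffun x => if x \in p then h x else g x].

(* The label [h y] ends in the inverse of [lower_sum f y], which by induction
   is [down_sum] at y and cancels in the recursion for [down_sum]. *)
Lemma down_sum_state (s p : seq P) v :
  (forall x y, (x < y)%O -> (index x s < index y s)%N) ->
  (forall y, y \in p -> lower_sum f y != 0) ->
  (forall x y, (x < y)%O -> y \in p -> x \in p) ->
  (forall y, (y < v)%O -> y \in p) ->
  down_sum (state p) v = lower_sum f v.
Proof.
move=> sinc Lp pdown.
(* The position in [s] strictly decreases on passing to a smaller element. *)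
have [n] := ubnP (index v s); elim: n v => // n IH v vn vp.
rewrite down_sumE lower_sumE; congr (_ + _); apply: eq_bigr => y /covers_inhat_lt yv.
rewrite IH; last 1 first.
- by move=> z zy; apply: pdown zy _; apply: vp.
- by rewrite !ffunE vp // -/f mulrVK //; apply/S_skew_field/Lp/vp.
- by apply: leq_trans (sinc _ _ yv) _.
Qed.

Lemma NAR_rcons p v :
  NAR C (rcons p v) g = obind (toggle C v) (NAR C p g).
Proof. by rewrite /NAR -cats1 foldl_cat. Qed.

(** Induction on the number of toggles. Pairing the [Theta] and [Nabla] conditions element by
    element lets each toggle contribute exactly its own pair to the domain. *)
Lemma NAR_prefix (s p : seq P) : linear_extension s -> prefix p s ->
  NAR C p g = if all (fun x => (up_sum g x != 0) && (lower_sum f x != 0)) p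
              then Some (state p) else None.
Proof.
case=> us sall sinc; elim/last_ind: p => [|p v IH] ps.
  by congr Some; apply/ffunP=> x; rewrite ffunE.
have pp : prefix p s by apply: prefix_trans ps; apply: prefix_rcons.
rewrite NAR_rcons IH // all_rcons andbC; case: ifP => //= /allP good.
have [t st] : exists t, s = rcons p v ++ t by apply/prefixP.
(* Membership in a prefix is a bound on the position in [s]; hence [p] is closed downwards, omits
   [v], and contains everything below [v]. *)
have mem_lt x : (x \in p) = (index x s < size p)%N.
  rewrite st -cats1 -catA index_cat; case: ifP => xp; first by rewrite index_mem.
  by rewrite ltnNge leq_addr.
have vs : index v s = size p.
  move: us; rewrite st -cats1 -catA index_cat cat_uniq /= => /and3P[_ + _].
  by rewrite negb_or => /andP[/negPf-> _]; rewrite eqxx addn0.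
have vp : v \notin p by rewrite mem_lt vs ltnn.
have low y : (y < v)%O -> y \in p by rewrite mem_lt -vs => /sinc.
have -> : toggle C v (state p) = if (up_sum g v != 0) && (lower_sum f v != 0)
    then Some (state (rcons p v)) else None.
  rewrite /toggle toggle_sumE (@down_sum_state s) //; first last.
  - by move=> x y /sinc xy; rewrite !mem_lt; apply: ltn_trans.
  - by move=> y /good/andP[].
  (* Elements above or equal to [v] come no earlier than [v] in [s], so they still carry their
     labels from [g]. *)
  rewrite (@eq_up_sum _ g); last first.
    move=> y vy; rewrite ffunE ifN // mem_lt -leqNgt -vs.
    by move: vy; rewrite le_eqVlt => /predU1P[->//|/sinc/ltnW].
  have [->|U0] /= := eqVneq (up_sum g v) 0; first by rewrite mulr0 eqxx.
  have [->|L0] /= := eqVneq (lower_sum f v) 0; first by rewrite mul0r eqxx.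
  have Uu := S_skew_field U0; have Lu := S_skew_field L0.
  (* A vanishing product would make the unit [up_sum g v] a non-unit. *)
  rewrite ifT; last by apply: contraTneq Uu => e; rewrite -(unitrMr _ Lu) e unitr0.
  congr Some; apply/ffunP=> x; rewrite !ffunE mem_rcons inE.
  (* Inversion reverses the factors, which puts the inverse of [up_sum g v] next to [C] and so forms
     [f v]. *)
  by case: eqP => //= ->; rewrite invrM // mulrA.
by rewrite andbC.
Qed.

(** Take the whole of [s] as prefix: it contains every element, so [state s] is [h], and the test of
    [NAR_prefix] is the conjunction of those of [Theta] and [Nabla]. *)
Lemma NAR_linear_extension (s : seq P) : linear_extension s ->
  NAR C s g =
  pcomp (@Nabla disp P S) (pcomp (@Theta disp P S C) (@DeltaInv disp P S)) g.
Proof.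
move=> sle; rewrite (NAR_prefix sle (prefix_refl s)) /pcomp DeltaInvE /= /Theta.
have sall : forall x, x \in s by case: sle.
have -> : [ffun x => C * ([ffun x => up_sum g x] x)^-1] = f.
  by apply/ffunP=> x; rewrite !ffunE.
case: (boolP [forall x, _]) => [/forallP U|/forallPn[x]]; last first.
  rewrite ffunE negbK => /eqP U0; rewrite ifN //.
  by apply/allPn; exists x => //; rewrite U0 eqxx.
rewrite /= /Nabla; case: (boolP [forall x, _]) => [/forallP L|/forallPn[x nL]].
  rewrite ifT; last by apply/allP=> x _; rewrite L andbT; move: (U x); rewrite ffunE.
  by congr Some; apply/ffunP=> x; rewrite !ffunE sall.
by rewrite ifN //; apply/allPn; exists x => //; rewrite negb_and nL orbT.
Qed.

End Transfer.

Theorem theorem5p26 (disp : Order.disp_t) (P : finPOrderType disp)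
    (S : unitRingType) (S_skew_field : GRing.field_axiom S)
    (S_infinite_field : contains_infinite_field S)
    (C : S) (C_central : forall a : S, GRing.comm C a)
    (s : seq P) (s_linext : linear_extension s) :
  forall g : {ffun P -> S},
    NAR C s g =
    pcomp (@Nabla disp P S) (pcomp (@Theta disp P S C) (@DeltaInv disp P S)) g.
Proof. by move=> g; apply: NAR_linear_extension. Qed.
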